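(* Assume the setting described in the context, and assume $\big\|\,\|h_p(\cdot,X)\|_{\mathcal H_{h_p}}\big\|_{\psi_2}<\infty$ for $X\sim\mathbb Q$. Let $X_1,\dots,X_n$ be i.i.d. $\sim\mathbb Q$, $\hat{\mathbb Q}_n=\{X_1,\dots,X_n\}$, and $S_p(\hat{\mathbb Q}_n)=\big(\frac1{n^2}\sum_{i,j=1}^nh_p(X_i,X_j)\big)^{1/2}$ (the V-statistic KSD estimator). Then $$\big|S_p(\mathbb Q)-S_p(\hat{\mathbb Q}_n)\big|=O_{\mathbb Q^n}\Big(\frac1{\sqrt n}\Big).$$
   Context: Let $k:\mathbb R^d\times\mathbb R^d\to\mathbb R$ be a measurable kernel, continuously differentiable in both arguments, with separable RKHS $\mathcal H_k$. Let $\mathbb P$ have a continuously differentiable density $p>0$ on $\mathbb R^d$ with $\lim_{\|x\|\to\infty}f(x)p(x)=0$ for all $f\in\mathcal H_k$. Stein kernel: $h_p(x,y)=\langle\nabla_x\log p(x),\nabla_y\log p(y)\rangle k(x,y)+\langle\nabla_y\log p(y),\nabla_xk(x,y)\rangle+\langle\nabla_x\log p(x),\nabla_yk(x,y)\rangle+\sum_{i=1}^d\partial^2k(x,y)/\partial x_i\partial y_i$, with RKHS $\mathcal H_{h_p}$ and feature map $x\mapsto h_p(\cdot,x)$. $\mathbb Q$ is a Borel probability measure on $\mathbb R^d$ and $S_p(\mathbb Q)=\|\mathbb E_{X\sim\mathbb Q}h_p(\cdot,X)\|_{\mathcal H_{h_p}}$ (kernel Stein discrepancy). $\|Y\|_{\psi_2}=\inf\{C>0:\mathbb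 E(e^{Y^2/C^2}-1)\le1\}$. $O_{\mathbb Q^n}(r_n)$ means that the quantity divided by $r_n$ is bounded in probability. *)

(* Defs.v *)
From HB Require Import structures.
From mathcomp Require Import all_boot all_order all_algebra.
From mathcomp Require Import all_classical all_reals all_analysis.

Set Implicit Arguments.
Unset Strict Implicit.
Unset Printing Implicit Defensive.

Import Order.TTheory GRing.Theory Num.Theory numFieldNormedType.Exports.

Local Open Scope classical_set_scope.
Local Open Scope ring_scope.

(* R^d is represented by row vectors 'rV[R]_d (normed space, so 'D_v f x    *)
(* derivatives are available).  We equip it with the sigma-algebra generated *)
(* by the d coordinate projections, i.e. the Borel sigma-algebra of R^d.    *)
Section rV_measurable.
Context (R : realType) (d : nat).

Definition rV_coord : 'I_d -> 'rV[R]_d -> R := fun i x => x ord0 i.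

Let rV_set0 : g_sigma_preimage rV_coord set0.
Proof. exact: sigma_algebra0. Qed.

Let rV_setC A : g_sigma_preimage rV_coord A -> g_sigma_preimage rV_coord (~` A).
Proof. exact: sigma_algebraC. Qed.

Let rV_bigcup (F : _^nat) : (forall i, g_sigma_preimage rV_coord (F i)) ->
  g_sigma_preimage rV_coord (\bigcup_i (F i)).
Proof. exact: sigma_algebra_bigcup. Qed.

HB.instance Definition _ := @isMeasurable.Build default_measure_display
  'rV[R]_d (g_sigma_preimage rV_coord) rV_set0 rV_setC rV_bigcup.

End rV_measurable.

Section stein.
Context {R : realType} {d : nat}.
Local Notation Rd := 'rV[R]_d.

Definition e_ (i : 'I_d) : Rd := delta_mx ord0 i.

Definition pderiv (f : Rd -> R) (x : Rd) (i : 'I_d) : R := 'D_(e_ i) f x.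

Definition grad_log (p : Rd -> R) (x : Rd) (i : 'I_d) : R :=
  pderiv (fun z => ln (p z)) x i.

Definition dx (k : Rd -> Rd -> R) (i : 'I_d) (x y : Rd) : R :=
  pderiv (fun z => k z y) x i.
Definition dy (k : Rd -> Rd -> R) (i : 'I_d) (x y : Rd) : R :=
  pderiv (fun w => k x w) y i.
Definition dxdy (k : Rd -> Rd -> R) (i : 'I_d) (x y : Rd) : R :=
  pderiv (fun z => dy k i z y) x i.

Definition stein_kernel (p : Rd -> R) (k : Rd -> Rd -> R) (x y : Rd) : R :=
  (\sum_(i < d) grad_log p x i * grad_log p y i) * k x y
  + \sum_(i < d) grad_log p y i * dx k i x y
  + \sum_(i < d) grad_log p x i * dy k i x y
  + \sum_(i < d) dxdy k i x y.

Definition psd_kernel (k : Rd -> Rd -> R) : Prop :=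
  (forall x y, k x y = k y x) /\
  forall (n : nat) (xs : 'I_n -> Rd) (a : 'I_n -> R),
    0 <= \sum_(i < n) \sum_(j < n) a i * a j * k (xs i) (xs j).

(* Norm in the RKHS H_k of a function f : R^d -> R (+oo iff f \notin H_k):
   ||f||_{H_k} = sup { |sum_i a_i f(x_i)| : ||sum_i a_i k(.,x_i)||_{H_k} <= 1 }. *)
Definition rkhs_norm (k : Rd -> Rd -> R) (f : Rd -> R) : \bar R :=
  ereal_sup [set r : \bar R | exists (n : nat) (xs : 'I_n -> Rd) (a : 'I_n -> R),
     \sum_(i < n) \sum_(j < n) a i * a j * k (xs i) (xs j) <= 1 /\
     r = (`| \sum_(i < n) a i * f (xs i) |)%:E].

Definition in_rkhs (k : Rd -> Rd -> R) (f : Rd -> R) : Prop :=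
  (rkhs_norm k f < +oo)%E.

Definition mean_embedding (Q : probability Rd R) (h : Rd -> Rd -> R) (x : Rd) : R :=
  \int[Q]_y h x y.

Definition KSD (p : Rd -> R) (k : Rd -> Rd -> R) (Q : probability Rd R) : \bar R :=
  rkhs_norm (stein_kernel p k) (mean_embedding Q (stein_kernel p k)).

Definition KSD_V (p : Rd -> R) (k : Rd -> Rd -> R) (n : nat) (xs : 'I_n -> Rd) : R :=
  Num.sqrt ((n%:R ^+ 2)^-1 *
    \sum_(i < n) \sum_(j < n) stein_kernel p k (xs i) (xs j)).

End stein.

Definition psi2_norm {R : realType} {dT : measure_display} {T : measurableType dT}
  (Q : probability T R) (Y : T -> R) : \bar R :=
  ereal_inf [set C%:E | C in [set C : R | 0 < C /\
     (\int[Q]_x ((expR (Y x ^+ 2 / C ^+ 2) - 1)%:E) <= 1)%E]].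

Definition mutually_independent {R : realType} {dO : measure_display}
  {Omega : measurableType dO} {dT : measure_display} {T : measurableType dT}
  (P : probability Omega R) (X : nat -> {RV P >-> T}) : Prop :=
  forall (s : seq nat) (A : nat -> set T), uniq s ->
    (forall i, i \in s -> measurable (A i)) ->
    P (\bigcap_(i in [set i | i \in s]) (X i @^-1` A i)) =
    (\prod_(i <- s) P (X i @^-1` A i))%E.

Definition bigO_in_prob {R : realType} {dO : measure_display}
  {Omega : measurableType dO} (P : probability Omega R)
  (Z : nat -> Omega -> \bar R) (r : nat -> R) : Prop :=
  forall eps : R, 0 < eps -> exists M : R, exists N : nat, forall n : nat,
    (N <= n)%N ->
    (P [set w | M%:E < Z n w * ((r n)^-1)%:E] < eps%:E)%E.

Arguments mutually_independent {R dO Omega dT T} P X.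
Arguments bigO_in_prob {R dO Omega} P Z r.

(* Main.v *)
Require Import Defs.
From HB Require Import structures.
From mathcomp Require Import all_boot all_order all_algebra.
From mathcomp Require Import all_classical all_reals all_analysis.
From mathcomp Require Import measurable_realfun ring lra.
Import Order.TTheory GRing.Theory Num.Theory numFieldNormedType.Exports.
Local Open Scope classical_set_scope.
Local Open Scope ring_scope.

(* Let h be the Stein kernel, mu the mean embedding of Q and mu_n that of the
   empirical measure, so that the two discrepancies are the RKHS norms of mu
   and mu_n and differ by at most ||mu - mu_n||.  For an i.i.d. sample,
   E ||mu - mu_n||^2 = (E h(X, X) - ||mu||^2) / n, which is finite because
   h(X, X) is the square of the sub-Gaussian variable ||h(., X)||; Markov's
   inequality concludes.

   No Hilbert space is constructed.  The kernel h is positive semidefinite as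
   a limit of combinations of second differences of k.  The only infinite
   combinations needed, those involving mu, are handled by averaging the
   positivity of h over a large sample and letting its size tend to infinity. *)

(** * Directional derivatives along lines: mean value theorem and limits as [t -> 0+] *)

Section differences.
Context {R : realType} {V : normedModType R}.
Implicit Types (f : V -> R) (x v : V).

(** The two difference quotients coincide; this gives access to the one-variable mean value theorem
    and chain rule. *)
Lemma is_derive_line f x v (s : R) : derivable f (s *: v + x) v ->
  is_derive s 1 (fun r : R => f (r *: v + x)) ('D_v f (s *: v + x)).
Proof.
move=> df.
have E : (fun h : R => h^-1 *: (((fun r : R => f (r *: v + x)) \o shift s) (h *: 1)
      - f (s *: v + x))) =
    (fun h : R => h^-1 *: ((f \o shift (s *: v + x)) (h *: v) - f (s *: v + x))).
  apply/funext => h /=; congr (_ *: (f _ - _)).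
  by rewrite scalerDl [h *: 1]mulr1 addrA.
by split; rewrite /derivable /derive E.
Qed.

Lemma MVT_line f x v (t : R) : 0 < t ->
  (forall s : R, derivable f (s *: v + x) v) ->
  exists2 c, 0 < c < t & f (t *: v + x) - f x = t * 'D_v f (c *: v + x).
Proof.
move=> t0 df.
have dfl s := is_derive_line _ _ _ _ (df s).
have [|c ct] := MVT t0 (fun s _ => dfl s).
  apply: continuous_subspaceT => s; apply: differentiable_continuous.
  by apply/derivable1_diffP; case: (dfl s).
rewrite subr0 scale0r add0r mulrC => E.
by exists c => //; move: ct; rewrite in_itv.
Qed.

Lemma derivable_cvg_at_right f x v : derivable f x v ->
  t^-1 * (f (t *: v + x) - f x) @[t --> 0^'+] --> 'D_v f x.
Proof. by move=> /cvg_ex[l fl]; apply: cvg_dnbhs_at_right; apply/cvg_ex; exists l. Qed.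

(** Meant for mean value points: [c t] is known only through [0 < c t < t], and squeezing is
    enough. *)
Lemma scale_shift_cvg_at_right v x (c : R -> R) :
  (forall t, 0 < t -> 0 < c t < t) -> c t *: v + x @[t --> 0^'+] --> x.
Proof.
move=> ct; rewrite -[X in _ --> X](add0r x); apply: cvgD; last exact: cvg_cst.
rewrite -[X in _ --> X](scale0r v); apply: cvgZr_tmp.
apply: (@squeeze_cvgr _ _ _ _ (cst 0) (@id R)).
- by near=> t; have /ct/andP[/ltW-> /ltW->] : 0 < t by near: t; exact: nbhs_right_gt.
- exact: cvg_cst.
- exact/cvg_at_right_filter/cvg_id.
Unshelve. all: end_near. Qed.

End differences.

Lemma cvg_sumr {R : realType} {T : Type} {F : set_system T} {FF : Filter F}
    (I : Type) (s : seq I) (f : I -> T -> R) (l : I -> R) :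
  (forall i, f i x @[x --> F] --> l i) ->
  \sum_(i <- s) f i x @[x --> F] --> \sum_(i <- s) l i.
Proof.
move=> fl; elim: s => [|i s ih].
  by rewrite big_nil; under eq_fun do rewrite big_nil; exact: cvg_cst.
by rewrite big_cons; under eq_fun do rewrite big_cons; exact: cvgD.
Qed.

(** * Positive semidefinite kernels, mixed second differences, summands of the Stein kernel *)

Section psd_kernels.
Context {R : realType} {d : nat}.
Local Notation Rd := 'rV[R]_d.
Implicit Types k : Rd -> Rd -> R.

(** Points and weights are chosen before [f], so one concatenation can be applied to each argument
    of a kernel in turn, and also to a mean embedding. *)
Lemma concat_weights (m n : nat) (xs : 'I_m -> Rd) (ys : 'I_n -> Rd)
    (a : 'I_m -> R) (b : 'I_n -> R) :
  exists (zs : 'I_(m + n) -> Rd) (c : 'I_(m + n) -> R), forall f : Rd -> R,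
    \sum_l c l * f (zs l) = \sum_i a i * f (xs i) + \sum_j b j * f (ys j).
Proof.
exists (fun l => match fintype.split l with inl i => xs i | inr j => ys j end).
exists (fun l => match fintype.split l with inl i => a i | inr j => b j end).
move=> f; rewrite big_split_ord /=; congr (_ + _); apply: eq_bigr => i _.
  by rewrite (unsplitK (inl _ i)).
by rewrite (unsplitK (inr _ i)).
Qed.

Lemma concat_weights_quadratic k (m n l : nat) (xs : 'I_m -> Rd) (ys : 'I_n -> Rd)
    (zs : 'I_l -> Rd) (a : 'I_m -> R) (b : 'I_n -> R) (c : 'I_l -> R) :
  (forall x y, k x y = k y x) ->
  (forall f : Rd -> R,
    \sum_i c i * f (zs i) = \sum_i a i * f (xs i) + \sum_j b j * f (ys j)) ->
  \sum_i \sum_j c i * c j * k (zs i) (zs j) =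
    \sum_i \sum_j a i * a j * k (xs i) (xs j)
    + 2 * \sum_i \sum_j a i * b j * k (xs i) (ys j)
    + \sum_i \sum_j b i * b j * k (ys i) (ys j).
Proof.
move=> ksym cE.
have nested (p q : nat) (us : 'I_p -> Rd) (vs : 'I_q -> Rd) s t :
    \sum_i \sum_j s i * t j * k (us i) (vs j) =
    \sum_i s i * \sum_j t j * k (us i) (vs j).
  by apply: eq_bigr => i _; rewrite mulr_sumr; apply: eq_bigr => j _; rewrite mulrA.
rewrite (nested _ _ zs zs) (cE (fun z => \sum_j c j * k z (zs j))).
under eq_bigr do rewrite (cE (k _)) mulrDr.
under [X in _ + X]eq_bigr do rewrite (cE (k _)) mulrDr.
rewrite !big_split /= -!nested.
rewrite [X in _ + (X + _)](_ : _ = \sum_i \sum_j a i * b j * k (xs i) (ys j)).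
  by rewrite mulrDl mul1r !addrA.
rewrite exchange_big; apply: eq_bigr => i _; apply: eq_bigr => j _.
by rewrite ksym [b j * _]mulrC.
Qed.

(** This is [||f + g||^2 >= 0] expanded, where [f] and [g] are the combinations of sections with
    weights [a] and [b]. *)
Lemma psd_kernel_sum2_ge0 k : psd_kernel k ->
  forall (m n : nat) (xs : 'I_m -> Rd) (ys : 'I_n -> Rd)
    (a : 'I_m -> R) (b : 'I_n -> R),
  0 <= \sum_(i < m) \sum_(j < m) a i * a j * k (xs i) (xs j)
     + 2 * \sum_(i < m) \sum_(j < n) a i * b j * k (xs i) (ys j)
     + \sum_(i < n) \sum_(j < n) b i * b j * k (ys i) (ys j).
Proof.
move=> [ksym kpsd] m n xs ys a b.
have [zs [c cE]] := concat_weights _ _ xs ys a b.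
by rewrite -(concat_weights_quadratic _ _ _ _ _ _ _ _ _ _ ksym cE).
Qed.

Definition second_difference k i (t : R) (x y : Rd) : R :=
  k (t *: e_ i + x) (t *: e_ i + y) - k x (t *: e_ i + y)
  - (k (t *: e_ i + x) y - k x y).

(** The mean value theorem is applied twice: in the second variable to [k (t *: e_ i + x) - k x],
    whose derivative is a difference of values of [dy k i], then in the first variable to that
    difference. *)
Lemma second_difference_MVT k i x y (t : R) : 0 < t ->
  (forall x y, derivable (fun w => k x w) y (e_ i)) ->
  (forall x y, derivable (fun z => dy k i z y) x (e_ i)) ->
  exists c : R * R, [/\ 0 < c.1 < t, 0 < c.2 < t &
    second_difference k i t x y =
      t ^+ 2 * dxdy k i (c.1 *: e_ i + x) (c.2 *: e_ i + y)].
Proof.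
move=> t0 dk ddk.
set x' := t *: e_ i + x.
have [s|c' c't E'] := @MVT_line _ _ ((k x') - (k x)) y (e_ i) t t0.
  exact: derivableB.
have [s|c ct E] := @MVT_line _ _ (fun z => dy k i z (c' *: e_ i + y)) x (e_ i) t t0.
  exact: ddk.
exists (c, c'); split => //=.
rewrite /second_difference -/x' [LHS]E' deriveB// expr2 -mulrA; congr (_ * _).
exact: E.
Qed.

Lemma second_difference_cvg k i x y :
  (forall x y, derivable (fun w => k x w) y (e_ i)) ->
  (forall x y, derivable (fun z => dy k i z y) x (e_ i)) ->
  continuous (fun xy : Rd * Rd => dxdy k i xy.1 xy.2) ->
  (t^-1) ^+ 2 * second_difference k i t x y @[t --> 0^'+] --> dxdy k i x y.
Proof.
move=> dk ddk cddk.
(* The mean value points become functions of [t]; [(0, 0)] is a default for [t <= 0], outside the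
   right neighbourhood. *)
have /choice[c cP] (t : R) : exists c : R * R, 0 < t -> [/\ 0 < c.1 < t, 0 < c.2 < t &
    second_difference k i t x y =
      t ^+ 2 * dxdy k i (c.1 *: e_ i + x) (c.2 *: e_ i + y)].
  have [t0|_] := ltP 0 t; last by exists (0, 0).
  by have [c ?] := second_difference_MVT _ _ x y _ t0 dk ddk; exists c.
apply: (@cvg_trans _ (dxdy k i ((c t).1 *: e_ i + x) ((c t).2 *: e_ i + y)
    @[t --> 0^'+])).
  apply: near_eq_cvg; near=> t.
  have t0 : 0 < t by near: t; exact: nbhs_right_gt.
  by have [_ _ ->] := cP _ t0; rewrite mulrA -exprMn mulVf ?gt_eqF// expr1n mul1r.
apply: (cvg_comp2 (G := nbhs x) (H := nbhs y)); last exact: cddk (x, y).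
- by apply: scale_shift_cvg_at_right => t /cP[].
- by apply: scale_shift_cvg_at_right => t /cP[].
Unshelve. all: end_near. Qed.

(** For symmetric [k] the second difference is symmetric in [x] and [y], and both derivatives are
    limits of it. *)
Lemma dxdy_sym k i x y : (forall x y, k x y = k y x) ->
  (forall x y, derivable (fun w => k x w) y (e_ i)) ->
  (forall x y, derivable (fun z => dy k i z y) x (e_ i)) ->
  continuous (fun xy : Rd * Rd => dxdy k i xy.1 xy.2) ->
  dxdy k i x y = dxdy k i y x.
Proof.
move=> ksym dk ddk cddk.
have c1 := second_difference_cvg k i x y dk ddk cddk.
have := second_difference_cvg k i y x dk ddk cddk.
have -> : (fun t => (t^-1) ^+ 2 * second_difference k i t y x) =
    (fun t => (t^-1) ^+ 2 * second_difference k i t x y).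
  apply/funext => t; congr (_ * _); rewrite /second_difference.
  rewrite (ksym (_ + y)) (ksym y (_ + x)) (ksym (_ + y) x) (ksym y x).
  by ring.
by move=> c2; apply: cvg_unique c1 c2.
Qed.

Lemma dx_dy_sym k i x y : (forall x y, k x y = k y x) -> dx k i x y = dy k i y x.
Proof. by move=> ksym; rewrite /dx /dy; congr pderiv; apply/funext => z. Qed.


(* Positivity: this is the limit, as t -> 0+, of the form L_x (x) L_y applied to
   k, where L_x f = u x * f x + (f (x + t e_i) - f x) / t. *)
Definition stein_summand (u : Rd -> R) k i (x y : Rd) : R :=
  u x * u y * k x y + u y * dx k i x y + u x * dy k i x y + dxdy k i x y.

Lemma stein_summand_psd u k i : psd_kernel k ->
  (forall x y, derivable (fun z => k z y) x (e_ i)) ->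
  (forall x y, derivable (fun w => k x w) y (e_ i)) ->
  (forall x y, derivable (fun z => dy k i z y) x (e_ i)) ->
  continuous (fun xy : Rd * Rd => dxdy k i xy.1 xy.2) ->
  psd_kernel (stein_summand u k i).
Proof.
move=> kpsd dkx dky ddk cddk; have [ksym _] := kpsd; split=> [x y|n xs a].
  rewrite /stein_summand (ksym x y) (dxdy_sym _ _ _ _ ksym dky ddk cddk).
  rewrite !(dx_dy_sym _ _ _ _ ksym) [u x * u y]mulrC -!addrA.
  by congr (_ + _); rewrite addrCA.
pose F t x y := u x * u y * k x y + u y * (t^-1 * (k (t *: e_ i + x) y - k x y))
  + u x * (t^-1 * (k x (t *: e_ i + y) - k x y))
  + (t^-1) ^+ 2 * second_difference k i t x y.
have Fcvg x y : F t x y @[t --> 0^'+] --> stein_summand u k i x y.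
  apply: cvgD; last exact: second_difference_cvg.
  apply: cvgD; [apply: cvgD; [exact: cvg_cst|]|]; apply: cvgMl_tmp.
  - exact: (derivable_cvg_at_right (fun z => k z y)).
  - exact: derivable_cvg_at_right.
have : \sum_(i < n) \sum_(j < n) a i * a j * F t (xs i) (xs j) @[t --> 0^'+] -->
    \sum_(i0 < n) \sum_(j < n) a i0 * a j * stein_summand u k i (xs i0) (xs j).
  by apply: cvg_sumr => i0; apply: cvg_sumr => j; apply: cvgMl_tmp.
move/cvgr_to_ge; apply.
near=> t.
(* The weights transpose [L]: [sum_j a_j (L f)(x_j)] puts [a_j (u x_j - 1/t)] on [x_j] and [a_j / t]
   on [x_j + t e_i]. *)
have := psd_kernel_sum2_ge0 _ kpsd _ _ xs (fun j => t *: e_ i + xs j)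
  (fun j => a j * (u (xs j) - t^-1)) (fun j => a j * t^-1).
congr (0 <= _).
rewrite mulrDl mul1r.
(* One of the two equal cross sums gets its indices exchanged, since [F] shifts either argument of
   [k]. *)
rewrite [X in _ + (_ + X)](_ : _ = \sum_(i1 < n) \sum_(j < n)
   a i1 * t^-1 * (a j * (u (xs j) - t^-1)) * k (t *: e_ i + xs i1) (xs j)); last first.
  rewrite exchange_big; apply: eq_bigr => i1 _; apply: eq_bigr => j _.
  by rewrite ksym; congr (_ * _); rewrite mulrC.
rewrite -!big_split; apply: eq_bigr => i1 _ /=.
rewrite -!big_split; apply: eq_bigr => j _ /=.
rewrite /F /second_difference; ring.
Unshelve. all: end_near. Qed.

Lemma psd_kernel_sum (I : Type) (s : seq I) (K : I -> Rd -> Rd -> R) :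
  (forall i, psd_kernel (K i)) -> psd_kernel (fun x y => \sum_(i <- s) K i x y).
Proof.
move=> Kpsd; split=> [x y|n xs a].
  by apply: eq_bigr => i _; case: (Kpsd i).
under eq_bigr do under eq_bigr do rewrite mulr_sumr.
under eq_bigr do rewrite exchange_big.
by rewrite exchange_big /=; apply: sumr_ge0 => i _; case: (Kpsd i) => _; apply.
Qed.

Lemma stein_kernelE (p : Rd -> R) k x y :
  stein_kernel p k x y = \sum_(i < d) stein_summand (grad_log p ^~ i) k i x y.
Proof.
by rewrite /stein_kernel mulr_suml -!big_split; apply: eq_bigr.
Qed.

(** Chain rule for [ln] and the restriction of [p] to the line through [x] along [e_ i]; continuity
    of the score follows from this formula. *)
Lemma grad_logE (p : Rd -> R) x i : (forall x, 0 < p x) ->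
  derivable p x (e_ i) -> grad_log p x i = (p x)^-1 * pderiv p x i.
Proof.
move=> p0 dp.
have x0 : x = 0 *: e_ i + x by rewrite scale0r add0r.
have dp0 : is_derive (0 : R) 1 (fun r : R => p (r *: e_ i + x)) (pderiv p x i).
  rewrite /pderiv [in X in 'D_(e_ i) p X]x0; apply: is_derive_line; rewrite -x0//.
have [_] := is_derive1_comp (is_derive1_ln (p0 (0 *: e_ i + x))) dp0.
rewrite -x0 => <-.
rewrite /grad_log /pderiv /derive.
by under [in RHS]eq_fun => h do rewrite /= -x0 addr0 [h%:A]mulr1.
Qed.

End psd_kernels.

(** * Positivity and joint continuity of the Stein kernel *)

Section stein_continuity.
Context {R : realType} {d : nat}.
Local Notation Rd := 'rV[R]_d.

Lemma stein_kernel_psd (p : Rd -> R) k : psd_kernel k ->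
  (forall (i : 'I_d) (x y : Rd),
     [/\ derivable (fun z => k z y) x (e_ i),
         derivable (fun w => k x w) y (e_ i) &
         derivable (fun z => dy k i z y) x (e_ i)]) ->
  (forall i, continuous (fun xy : Rd * Rd => dxdy k i xy.1 xy.2)) ->
  psd_kernel (stein_kernel p k).
Proof.
move=> kpsd dk ck.
have -> : stein_kernel p k =
    fun x y => \sum_(i < d) stein_summand (grad_log p ^~ i) k i x y.
  by apply/funext => x; apply/funext => y; exact: stein_kernelE.
by apply: psd_kernel_sum => i; apply: stein_summand_psd => // x y;
  case: (dk i x y).
Qed.

Lemma grad_log_continuous (p : Rd -> R) i : (forall x, 0 < p x) ->
  continuous p -> (forall x, derivable p x (e_ i)) ->
  continuous (fun x => pderiv p x i) -> continuous (fun x => grad_log p x i).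
Proof.
move=> p0 cp dp cdp x.
rewrite (_ : (fun x => _) = (fun x => (p x)^-1 * pderiv p x i)).
  exact: cvgM (cvgV (lt0r_neq0 (p0 x)) (cp x)) (cdp x).
by apply/funext => y; exact: grad_logE.
Qed.

Lemma stein_kernel_continuous (p : Rd -> R) k :
  continuous (fun xy : Rd * Rd => k xy.1 xy.2) ->
  (forall i : 'I_d,
     [/\ continuous (fun xy : Rd * Rd => dx k i xy.1 xy.2),
         continuous (fun xy : Rd * Rd => dy k i xy.1 xy.2) &
         continuous (fun xy : Rd * Rd => dxdy k i xy.1 xy.2)]) ->
  (forall i, continuous (fun x => grad_log p x i)) ->
  continuous (fun xy : Rd * Rd => stein_kernel p k xy.1 xy.2).
Proof.
move=> ck cdk cg.
have -> : (fun xy : Rd * Rd => stein_kernel p k xy.1 xy.2) =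
    fun xy => \sum_(i < d) stein_summand (grad_log p ^~ i) k i xy.1 xy.2.
  by apply/funext => xy; exact: stein_kernelE.
move=> [x y].
apply: cvg_sumr => i.
have c1 : grad_log p xy.1 i @[xy --> (x, y)] --> grad_log p x i.
  apply: (cvg_comp fst (fun z => grad_log p z i)); [exact: cvg_fst|exact: cg].
have c2 : grad_log p xy.2 i @[xy --> (x, y)] --> grad_log p y i.
  apply: (cvg_comp snd (fun z => grad_log p z i)); [exact: cvg_snd|exact: cg].
have [cdx cdy cdd] := cdk i.
apply: cvgD; last exact: cdd (x, y).
apply: cvgD; last by apply: cvgM c1 (cdy (x, y)).
apply: cvgD; last by apply: cvgM c2 (cdx (x, y)).
by apply: cvgM (ck (x, y)); exact: cvgM.
Qed.

End stein_continuity.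

(** * Measurability of continuous functions of two vectors *)

Lemma measurable_fun_countable_factor {dT dU : measure_display}
    {T : measurableType dT} {U : measurableType dU} (C : countType)
    (g : T -> C) (f : C -> U) :
  (forall c, measurable (g @^-1` [set c])) -> measurable_fun setT (f \o g).
Proof.
move=> mg _ B mB; rewrite setTI.
have -> : (f \o g) @^-1` B =
    \bigcup_c (if f c \in B then g @^-1` [set c] else set0).
  apply/seteqP; split=> x /= => [Bx|[c _]].
    by exists (g x) => //; rewrite mem_set.
  by case: ifPn => // /set_mem Bc /= ->.
by apply: countable_bigcupT_measurable => // c; case: ifPn.
Qed.

Section rV_measurability.
Context {R : realType} {d : nat}.
Local Notation Rd := 'rV[R]_d.

Lemma measurable_rV_coord i : measurable_fun setT (fun x : Rd => x ord0 i).
Proof.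
move=> _ B mB; apply: sub_sigma_algebra.
by rewrite (bigD1 i)//=; left; exists B.
Qed.

(* Rounding each coordinate down to the grid of mesh 1 / n.+1 factors through a
   countable type, and converges to the identity. *)
Definition rV_floor n (x : Rd) : 'rV[int]_d :=
  \row_j Num.floor (n.+1%:R * x ord0 j).
Definition rV_grid n (v : 'rV[int]_d) : Rd := \row_j ((v ord0 j)%:~R / n.+1%:R).

Lemma measurable_rV_floor_fiber n v : measurable (rV_floor n @^-1` [set v]).
Proof.
have -> : rV_floor n @^-1` [set v] = \bigcap_(j in [set: 'I_d])
    ((fun x : Rd => n.+1%:R * x ord0 j) @^-1`
      `[(v ord0 j)%:~R, (v ord0 j + 1)%:~R[).
  apply/seteqP; split=> [x /= <- j _|x /= xv].
    by rewrite /= in_itv/= mxE floor_itv.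
  apply/rowP => j; rewrite mxE; apply: floor_def.
  by have := xv j I; rewrite /= in_itv.
apply: fin_bigcap_measurable => // j _.
rewrite -[X in measurable X]setTI; apply: measurable_funM => //.
exact: measurable_rV_coord.
Qed.

Lemma rV_grid_floor_cvg (x : Rd) : rV_grid n (rV_floor n x) @[n --> \oo] --> x.
Proof.
apply/cvg_ballP => e e0; near=> n; split=> // i j.
rewrite ord1 !mxE /ball /= .
have n0 : (0 : R) < n.+1%:R by [].
have ne : n.+1%:R^-1 < e by near: n; exact: (near_infty_natSinv_lt (PosNum e0)).
have /andP[l1 l2] := floor_itv (n.+1%:R * x ord0 j).
apply: le_lt_trans ne.
rewrite -(ler_pM2l n0) mulfV ?gt_eqF//.
rewrite -{1}(gtr0_norm n0) -normrM mulrBr mulrCA mulfV ?gt_eqF// mulr1.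
rewrite intrD in l2; rewrite ler_norml; lra.
Unshelve. all: end_near. Qed.

(** The sigma-algebra comes from coordinates rather than open sets, so [f] is obtained as the
    pointwise limit of its compositions with grid rounding, each factoring through a countable
    type. *)
Lemma continuous_rV2_measurable (f : Rd * Rd -> R) :
  continuous f -> measurable_fun setT f.
Proof.
move=> cf.
pose q n (x : Rd * Rd) := (rV_floor n x.1, rV_floor n x.2).
pose g n (v : 'rV[int]_d * 'rV[int]_d) := f (rV_grid n v.1, rV_grid n v.2).
apply: (@measurable_fun_cvg _ _ _ _ (fun n => g n \o q n)) => [n|[x y] _].
  apply: measurable_fun_countable_factor => -[v w].
  rewrite (_ : _ @^-1` _ = rV_floor n @^-1` [set v] `*` rV_floor n @^-1` [set w]).
    by apply: measurableX; exact: measurable_rV_floor_fiber.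
  by apply/seteqP; split=> -[a b] /=; rewrite /q /= => -[-> ->].
apply: (cvg_comp2 (h := fun a b => f (a, b))
  (rV_grid_floor_cvg x) (rV_grid_floor_cvg y)).
rewrite (_ : (fun _ => _) = f); first exact: cf.
by apply/funext => -[].
Qed.

End rV_measurability.

(** * RKHS norms of finite combinations of sections, by duality *)

Section rkhs_norms.
Context {R : realType} {d : nat}.
Local Notation Rd := 'rV[R]_d.
Variable h : Rd -> Rd -> R.
Hypothesis hpsd : psd_kernel h.

(** With [L] the paired sum and [Qa], [Qb] the quadratic forms, positivity for the weights [- L * a]
    and [b] reads [0 <= L^2 Qa - 2 L^2 + Qb]; as [Qa <= 1], [L^2 <= Qb]. *)
Lemma psd_kernel_CauchySchwarz (m n : nat) (xs : 'I_m -> Rd) (ys : 'I_n -> Rd)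
    (a : 'I_m -> R) (b : 'I_n -> R) :
  \sum_(i < m) \sum_(j < m) a i * a j * h (xs i) (xs j) <= 1 ->
  `|\sum_(i < m) a i * \sum_(j < n) b j * h (xs i) (ys j)| <=
    Num.sqrt (\sum_(i < n) \sum_(j < n) b i * b j * h (ys i) (ys j)).
Proof.
set Qa := (X in X <= 1); set L := (X in `|X|); set Qb := (X in Num.sqrt X).
move=> Qa1.
have := psd_kernel_sum2_ge0 _ hpsd _ _ xs ys (fun i => - L * a i) b.
under eq_bigr do under eq_bigr do rewrite mulrACA mulrNN -mulrA.
under eq_bigr do rewrite -mulr_sumr.
rewrite -mulr_sumr -/Qa -/Qb.
under eq_bigr do under eq_bigr do rewrite -!mulrA.
under eq_bigr do rewrite -mulr_sumr -mulr_sumr.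
rewrite -mulr_sumr -/L => q0.
rewrite -sqrtr_sqr ler_wsqrtr//.
have : L ^+ 2 * Qa <= L ^+ 2 * 1 by apply: ler_wpM2l => //; exact: sqr_ge0.
move: q0; rewrite expr2; lra.
Qed.

Lemma rkhs_norm_ge0 f : (0 <= rkhs_norm h f)%E.
Proof.
apply: ereal_sup_ubound; exists 0%N, (fun=> 0), (fun=> 0).
by rewrite !big_ord0 normr0.
Qed.

(** Cauchy-Schwarz bounds the supremum, and the weights [b / sqrt q] attain it. *)
Lemma rkhs_norm_sum_sections (n : nat) (ys : 'I_n -> Rd) (b : 'I_n -> R) :
  rkhs_norm h (fun z => \sum_(j < n) b j * h z (ys j)) =
  (Num.sqrt (\sum_(i < n) \sum_(j < n) b i * b j * h (ys i) (ys j)))%:E.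
Proof.
set q := (X in Num.sqrt X).
apply/eqP; rewrite eq_le; apply/andP; split.
  apply: ge_ereal_sup => _ [m [xs [a [a1 ->]]]].
  by rewrite lee_fin psd_kernel_CauchySchwarz.
(* Normalising needs [q > 0]; otherwise the lower bound is nonnegativity of the norm. *)
have [q0|q0] := eqVneq (Num.sqrt q) 0; first by rewrite q0 rkhs_norm_ge0.
have qpos : 0 < q by rewrite -sqrtr_gt0 lt_neqAle eq_sym q0 sqrtr_ge0.
apply: ereal_sup_ubound; exists n, ys, (fun j => b j / Num.sqrt q).
have qq : Num.sqrt q ^+ 2 = q by rewrite sqr_sqrtr// ltW.
have E1 : \sum_(i < n) \sum_(j < n)
   b i / Num.sqrt q * (b j / Num.sqrt q) * h (ys i) (ys j) = q^-1 * q.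
  rewrite mulr_sumr; apply: eq_bigr => i _; rewrite mulr_sumr; apply: eq_bigr => j _.
  by rewrite -{3}qq; field.
have E2 : \sum_(i < n) b i / Num.sqrt q * \sum_(j < n) b j * h (ys i) (ys j) =
   (Num.sqrt q)^-1 * q.
  rewrite [in RHS]/q mulr_sumr; apply: eq_bigr => i _.
  rewrite !mulr_sumr; apply: eq_bigr => j _; ring.
rewrite E1 E2 mulVf ?gt_eqF//; split=> //; congr (_%:E).
by rewrite -[X in _ * X]qq expr2 mulKf// ger0_norm ?sqrtr_ge0.
Qed.

Lemma rkhs_norm_section x :
  rkhs_norm h (fun z => h z x) = (Num.sqrt (h x x))%:E.
Proof.
have := rkhs_norm_sum_sections 1 (fun=> x) (fun=> 1).
rewrite !big_ord1 !mul1r => <-; congr rkhs_norm.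
by apply/funext => z; rewrite big_ord1 mul1r.
Qed.

Lemma rkhs_norm_le_add f g (D : R) :
  (forall (m : nat) (xs : 'I_m -> Rd) (a : 'I_m -> R),
    \sum_(i < m) \sum_(j < m) a i * a j * h (xs i) (xs j) <= 1 ->
    `|\sum_(i < m) a i * (f (xs i) - g (xs i))| <= D) ->
  (rkhs_norm h f <= rkhs_norm h g + D%:E)%E.
Proof.
move=> fgD; apply: ge_ereal_sup => _ [m [xs [a [a1 ->]]]].
apply: (@le_trans _ _ ((`|\sum_(i < m) a i * g (xs i)|)%:E + D%:E)%E).
  rewrite -EFinD lee_fin -lerBlDl (le_trans (lerB_dist _ _))//.
  rewrite -sumrB; under eq_bigr do rewrite -mulrBr; exact: fgD.
by rewrite leeD2r//; apply: ereal_sup_ubound; exists m, xs, a.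
Qed.

(** A reverse triangle inequality. The norm of [f] could a priori be infinite; it is bounded by the
    finite norm of the combination plus [D]. *)
Lemma rkhs_norm_dist_le f (n : nat) (ys : 'I_n -> Rd) (b : 'I_n -> R) (D : R) :
  (forall (m : nat) (xs : 'I_m -> Rd) (a : 'I_m -> R),
    \sum_(i < m) \sum_(j < m) a i * a j * h (xs i) (xs j) <= 1 ->
    `|\sum_(i < m) a i * (f (xs i) - \sum_(j < n) b j * h (xs i) (ys j))| <= D) ->
  (`|rkhs_norm h f -
    (Num.sqrt (\sum_(i < n) \sum_(j < n) b i * b j * h (ys i) (ys j)))%:E| <=
   D%:E)%E.
Proof.
move=> fD; pose g z := \sum_(j < n) b j * h z (ys j).
have le1 : (rkhs_norm h f <= rkhs_norm h g + D%:E)%E by exact: rkhs_norm_le_add.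
have le2 : (rkhs_norm h g <= rkhs_norm h f + D%:E)%E.
  apply: rkhs_norm_le_add => m xs a a1; rewrite -normrN -sumrN.
  by under eq_bigr do rewrite -mulrN opprB; exact: fD.
move: le1 le2 (rkhs_norm_ge0 f); rewrite rkhs_norm_sum_sections.
case: (rkhs_norm h f) => [r| |]//=.
by rewrite -!EFinD !lee_fin ler_norml => le1 le2 _; apply/andP; split; lra.
Qed.

End rkhs_norms.

(** * Expectations: linearity, Markov's inequality, change of variables *)

Section has_mean.
Context {R : realType} {dT : measure_display} {T : measurableType dT}.
Variable P : probability T R.
Implicit Types f g : T -> R.

(** Integrability is included because the real-valued integral is [0] also when the extended one is
    infinite. *)
Definition has_mean f (v : R) : Prop :=
  P.-integrable setT (EFin \o f) /\ \int[P]_x f x = v.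

Lemma has_mean_cst (c : R) : has_mean (fun=> c) c.
Proof.
split; first exact: finite_measure_integrable_cst.
have P1 : P setT = 1%E := probability_setT P.
by rewrite Rintegral_cst//= P1 mulr1.
Qed.

Lemma has_meanD f g u v : has_mean f u -> has_mean g v ->
  has_mean (fun x => f x + g x) (u + v).
Proof.
move=> [fi <-] [gi <-]; split; last by rewrite RintegralD.
exact: (integrableD measurableT fi gi).
Qed.

Lemma has_meanZ (c : R) f u : has_mean f u -> has_mean (fun x => c * f x) (c * u).
Proof.
by move=> [fi <-]; split; [exact: (integrableZl measurableT c fi)|rewrite RintegralZl].
Qed.

Lemma has_mean_sum (I : Type) (s : seq I) (f : I -> T -> R) (u : I -> R) :
  (forall i, has_mean (f i) (u i)) ->
  has_mean (fun x => \sum_(i <- s) f i x) (\sum_(i <- s) u i).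
Proof.
move=> fu; elim: s => [|i s ih].
  by rewrite big_nil; under eq_fun do rewrite big_nil; exact: has_mean_cst.
by rewrite big_cons; under eq_fun do rewrite big_cons; exact: has_meanD.
Qed.

Lemma has_mean_ge0 f u : (forall x, 0 <= f x) -> has_mean f u -> 0 <= u.
Proof. by move=> f0 [_ <-]; exact: Rintegral_ge0. Qed.

Lemma has_mean_markov f u (e : R) : (forall x, 0 <= f x) -> has_mean f u ->
  0 < e -> (P [set x | (e <= f x)%R] <= (u / e)%:E)%E.
Proof.
move=> f0 [fi <-] e0.
have := @le_integral_comp_abse _ _ _ P setT measurableT (EFin \o f) e id
  (@measurable_id _ _ _) (fun r H => H) (fun x y _ _ H => H)
  (measurable_int _ fi) e0.
rewrite setTI.
under eq_set do rewrite /= lee_fin ger0_norm//.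
under eq_integral do rewrite gee0_abs ?lee_fin//.
move=> H; rewrite /Rintegral EFinM fineK; last exact: integrable_fin_num.
by rewrite lee_pdivlMr// muleC.
Qed.

End has_mean.

Lemma has_mean_distribution {R : realType} {dO dT : measure_display}
    {Omega : measurableType dO} {T : measurableType dT}
    (P : probability Omega R) (Q : probability T R) (Y : {RV P >-> T})
    (f : T -> R) (v : R) :
  (forall A, measurable A -> distribution P Y A = Q A) ->
  measurable_fun setT f -> has_mean Q f v -> has_mean P (f \o Y) v.
Proof.
move=> YQ mf [fi <-].
have mfE : measurable_fun setT (EFin \o f) by exact/measurable_EFinP.
have fYi : P.-integrable setT ((EFin \o f) \o Y).
  apply/integrableP; split; first exact: measurableT_comp.
  have /integrableP[_] := fi; congr (_ < _)%E.
  have mfA : measurable_fun setT (fun y => `|(f y)%:E|%E) by exact: measurableT_comp.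
  rewrite -(@ge0_integral_distribution _ _ _ _ _ _ Y _ mfA)//.
  by apply: eq_measure_integral => A mA _; exact/esym/YQ.
split=> //; congr fine.
rewrite -(integral_distribution mfE fYi).
by apply: eq_measure_integral => A mA _; exact: YQ.
Qed.

(** * Joint law of two independent variables *)

Section independent_pairs.
Context {R : realType} {dO dT : measure_display}
  {Omega : measurableType dO} {T : measurableType dT}.
Variables (P : probability Omega R) (Q : probability T R).
Variable X : nat -> {RV P >-> T}.
Hypothesis Xindep : mutually_independent P X.
Hypothesis XQ : forall i A, measurable A -> distribution P (X i) A = Q A.

Lemma measurable_pair_RV i j : measurable_fun setT (fun w => (X i w, X j w)).
Proof. by apply: measurable_fun_pair; exact: measurable_funPT. Qed.

Definition pair_RV i j : {RV P >-> (T * T)%type} :=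
  HB.pack_for {mfun Omega >-> (T * T)%type} (fun w => (X i w, X j w))
    (@isMeasurableFun.Build _ _ Omega (T * T)%type _ (measurable_pair_RV i j)).

(** The product measure is determined by rectangles, on which the equality is independence of [X i]
    and [X j]. *)
Lemma distribution_pair_RV i j A : i != j -> measurable A ->
  distribution P (pair_RV i j) A = (Q \x Q)%E A.
Proof.
move=> ij mA; apply/esym.
apply: (product_measure_unique (m' := distribution P (pair_RV i j))) => // B C mB mC.
transitivity (P (X i @^-1` B) * P (X j @^-1` C))%E; last first.
  by congr (_ * _)%E; exact: XQ.
have /(_ [:: i; j] (fun l => if l == i then B else C)) := Xindep.
rewrite /= inE ij big_cons big_cons big_nil mule1 eqxx eq_sym (negbTE ij).
move=> /(_ isT) H; rewrite /distribution /pushforward -H.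
  congr (P _); apply/seteqP; split=> [w /= [Bw Cw] l|w /= BCw].
    by rewrite /= !inE => /orP[] /eqP ->; rewrite ?eqxx// eq_sym (negbTE ij).
  split.
    by have := BCw i; rewrite /= !inE eqxx; apply.
  by have := BCw j; rewrite /= !inE eqxx orbT eq_sym (negbTE ij); apply.
by move=> l; case: ifP.
Qed.

End independent_pairs.

(** * Integrability of the kernel and of its mean embedding *)

Section kernel_means.
Context {R : realType} {d : nat}.
Local Notation Rd := 'rV[R]_d.
Variables (Q : probability Rd R) (h : Rd -> Rd -> R).
Hypothesis hpsd : psd_kernel h.
Hypothesis mh : measurable_fun setT (fun xy : Rd * Rd => h xy.1 xy.2).
Hypothesis hdiag : Q.-integrable setT (fun x => (h x x)%:E).

Let mu := mean_embedding Q h.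
Let K := \int[Q]_x h x x.
Let B := \int[Q]_x mu x.

(** Positivity with weights [(1, 1)] and [(-1, 1)] on [x], [y]. The bound separates the variables,
    so integrability of the diagonal controls sections and pairs. *)
Lemma psd_kernel_norm_le x y : `|h x y| <= 2^-1 * (h x x + h y y).
Proof.
have q s := psd_kernel_sum2_ge0 _ hpsd 1 1 (fun=> x) (fun=> y) (fun=> s) (fun=> 1).
have := q 1; have := q (-1); rewrite !big_ord1 !mul1r !mulr1 mulrNN mulr1 !mul1r.
by move=> q1 q2; rewrite ler_norml; apply/andP; split; lra.
Qed.

Lemma measurable_kernel_section x : measurable_fun setT (h x).
Proof. exact: (measurable_fun_pair2 x mh). Qed.

Lemma measurable_kernel_diag : measurable_fun setT (fun x => h x x).
Proof.
apply: (measurableT_comp (f := fun xy : Rd * Rd => h xy.1 xy.2)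
  (g := fun x => (x, x))) => //.
exact: measurable_fun_pair.
Qed.

Lemma has_mean_kernel_diag : has_mean Q (fun x => h x x) K.
Proof. by []. Qed.

Lemma has_mean_kernel_section x : has_mean Q (h x) (mu x).
Proof.
split=> //.
have [gi _] := has_meanZ Q 2^-1 _ _
  (has_meanD _ _ _ _ _ (has_mean_cst Q (h x x)) has_mean_kernel_diag).
apply: (le_integrable measurableT _ _ gi).
  by apply/measurable_EFinP; exact: measurable_kernel_section.
move=> y _ /=; rewrite lee_fin (le_trans (psd_kernel_norm_le x y))//.
exact: ler_norm.
Qed.

(** The projections are packaged as random variables of law [Q], so that [has_mean_distribution]
    integrates the diagonal terms over pairs. *)
Definition fst_RV : {RV (Q \x Q)%E >-> Rd} :=
  HB.pack_for {mfun (Rd * Rd)%type >-> Rd} fst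
    (@isMeasurableFun.Build _ _ (Rd * Rd)%type Rd _ measurable_fst).

Definition snd_RV : {RV (Q \x Q)%E >-> Rd} :=
  HB.pack_for {mfun (Rd * Rd)%type >-> Rd} snd
    (@isMeasurableFun.Build _ _ (Rd * Rd)%type Rd _ measurable_snd).

Lemma distribution_fst_RV A : measurable A -> distribution (Q \x Q)%E fst_RV A = Q A.
Proof.
move=> mA; rewrite /distribution /pushforward /= -setXT.
have Q1 : Q setT = 1%E := probability_setT Q.
by rewrite product_measure1E//= Q1 mule1.
Qed.

Lemma distribution_snd_RV A : measurable A -> distribution (Q \x Q)%E snd_RV A = Q A.
Proof.
move=> mA; rewrite /distribution /pushforward /= -setTX.
have Q1 : Q setT = 1%E := probability_setT Q.
by rewrite product_measure1E//= Q1 mul1e.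
Qed.

Lemma integrable_kernel_prod :
  (Q \x Q)%E.-integrable setT (fun xy : Rd * Rd => (h xy.1 xy.2)%:E).
Proof.
have i1 := has_mean_distribution _ _ _ _ _ distribution_fst_RV
  measurable_kernel_diag has_mean_kernel_diag.
have i2 := has_mean_distribution _ _ _ _ _ distribution_snd_RV
  measurable_kernel_diag has_mean_kernel_diag.
have [gi _] := has_meanZ _ 2^-1 _ _ (has_meanD _ _ _ _ _ i1 i2).
apply: (le_integrable measurableT _ _ gi); first exact/measurable_EFinP.
move=> y _ /=; rewrite lee_fin (le_trans (psd_kernel_norm_le _ _))//.
exact: ler_norm.
Qed.

(** Recognising [mu] as the inner integral of Fubini's theorem yields its integrability and the
    value of the double integral. *)
Lemma mean_embedding_fubiniE :
  fubini_F Q (fun xy : Rd * Rd => (h xy.1 xy.2)%:E) = EFin \o mu.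
Proof.
apply/funext => x; rewrite /fubini_F /mu /mean_embedding /Rintegral /=.
by rewrite fineK//; apply: integrable_fin_num => //; case: (has_mean_kernel_section x).
Qed.

Lemma has_mean_mean_embedding : has_mean Q mu B.
Proof.
split=> //; rewrite -mean_embedding_fubiniE.
by apply: integrable_fubini_F; exact: integrable_kernel_prod.
Qed.

Lemma measurable_mean_embedding : measurable_fun setT mu.
Proof. by case: has_mean_mean_embedding => /measurable_int /measurable_EFinP. Qed.

Lemma has_mean_kernel_prod : has_mean (Q \x Q)%E (fun xy => h xy.1 xy.2) B.
Proof.
split; first exact: integrable_kernel_prod.
rewrite /B /Rintegral -(integral12_prod_meas1 integrable_kernel_prod).
by rewrite mean_embedding_fubiniE.
Qed.

End kernel_means.

(** * The i.i.d. sample: expected squared distance and rate of convergence *)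

Lemma sum_diag_const {R : realType} (n : nat) (K B : R) : (0 < n)%N ->
  \sum_(i < n) \sum_(j < n)
    n%:R^-1 * n%:R^-1 * (if (i : nat) == j then K else B) = B + (K - B) / n%:R.
Proof.
move=> n0.
have n0R : n%:R != 0 :> R by rewrite pnatr_eq0 -lt0n.
(* Row [i] has one diagonal entry [K] and [n - 1] entries [B]. *)
have E (i : 'I_n) : \sum_(j < n)
    n%:R^-1 * n%:R^-1 * (if (i : nat) == j then K else B) =
    n%:R^-1 * n%:R^-1 * (K - B) + n%:R^-1 * B.
  rewrite (bigD1 i)//= eqxx (eq_bigr (fun=> n%:R^-1 * n%:R^-1 * B)); last first.
    by move=> j ji; rewrite ifN// eq_sym.
  rewrite (_ : \sum_(j < n | j != i) _ =
      \sum_(j < n) (n%:R^-1 * n%:R^-1 * B) - n%:R^-1 * n%:R^-1 * B); last first.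
    by rewrite [X in _ = X - _](bigD1 i)//= addrAC subrr add0r.
  rewrite sumr_const card_ord -mulr_natl; field.
  exact: n0R.
under eq_bigr do rewrite E.
rewrite sumr_const card_ord -mulr_natl; field.
exact: n0R.
Qed.

Section iid_kernel.
Context {R : realType} {d : nat} {dO : measure_display}
  {Omega : measurableType dO}.
Local Notation Rd := 'rV[R]_d.
Variables (P : probability Omega R) (Q : probability Rd R) (h : Rd -> Rd -> R).
Variable X : nat -> {RV P >-> Rd}.
Hypothesis hpsd : psd_kernel h.
Hypothesis mh : measurable_fun setT (fun xy : Rd * Rd => h xy.1 xy.2).
Hypothesis hdiag : Q.-integrable setT (fun x => (h x x)%:E).
Hypothesis Xindep : mutually_independent P X.
Hypothesis XQ : forall i A, measurable A -> distribution P (X i) A = Q A.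

Let mu := mean_embedding Q h.
Let K := \int[Q]_x h x x.
Let B := \int[Q]_x mu x.

Lemma has_mean_kernel_sample i j :
  has_mean P (fun w => h (X i w) (X j w)) (if i == j then K else B).
Proof.
have [<-|ij] := eqVneq i j.
  exact: (has_mean_distribution P Q (X i) (fun x => h x x) K (XQ i)
    (measurable_kernel_diag _ mh) (has_mean_kernel_diag _ _ hdiag)).
exact: (has_mean_distribution P _ (pair_RV P X i j) (fun xy => h xy.1 xy.2) B
  (fun A => distribution_pair_RV P Q X Xindep XQ i j A ij) mh
  (has_mean_kernel_prod _ _ hpsd mh hdiag)).
Qed.

Lemma has_mean_Vstatistic n : (0 < n)%N ->
  has_mean P (fun w => \sum_(i < n) \sum_(j < n)
    n%:R^-1 * n%:R^-1 * h (X i w) (X j w)) (B + (K - B) / n%:R).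
Proof.
move=> n0; rewrite -sum_diag_const//.
apply: has_mean_sum => i; apply: has_mean_sum => j.
exact/has_meanZ/has_mean_kernel_sample.
Qed.

Lemma has_mean_section_sample z j : has_mean P (fun w => h z (X j w)) (mu z).
Proof.
exact: (has_mean_distribution P Q (X j) (h z) (mu z) (XQ j)
  (measurable_kernel_section _ mh z) (has_mean_kernel_section _ _ hpsd mh hdiag z)).
Qed.

Lemma has_mean_embedding_sample j : has_mean P (fun w => mu (X j w)) B.
Proof.
exact: (has_mean_distribution P Q (X j) mu B (XQ j)
  (measurable_mean_embedding _ _ hpsd mh hdiag)
  (has_mean_mean_embedding _ _ hpsd mh hdiag)).
Qed.

(* Positivity of h on the points z and the sample X_0, ..., X_n, averaged over
   the sample, is this inequality up to an error of order 1 / n. *)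
Lemma embedding_quadratic_ge0 m (zs : 'I_m -> Rd) (c : 'I_m -> R) :
  0 <= B + 2 * \sum_i c i * mu (zs i)
    + \sum_i \sum_j c i * c j * h (zs i) (zs j).
Proof.
set q := (X in 0 <= X).
have qn n : 0 <= q + (K - B) / n.+1%:R.
  apply: (@has_mean_ge0 _ _ _ P (fun w =>
    \sum_(i < m) \sum_(j < m) c i * c j * h (zs i) (zs j)
    + 2 * \sum_(i < m) \sum_(j < n.+1) c i * n.+1%:R^-1 * h (zs i) (X j w)
    + \sum_(i < n.+1) \sum_(j < n.+1)
        n.+1%:R^-1 * n.+1%:R^-1 * h (X i w) (X j w))).
    by move=> w; exact: (psd_kernel_sum2_ge0 _ hpsd _ _ zs (fun j => X j w)).
  have -> : q + (K - B) / n.+1%:R = \sum_i \sum_j c i * c j * h (zs i) (zs j)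
      + 2 * \sum_(i < m) \sum_(j < n.+1) c i * n.+1%:R^-1 * mu (zs i)
      + (B + (K - B) / n.+1%:R).
    have -> : \sum_(i < m) \sum_(j < n.+1) c i * n.+1%:R^-1 * mu (zs i) =
        \sum_i c i * mu (zs i).
      apply: eq_bigr => i _; rewrite sumr_const card_ord -mulr_natl; field.
      by rewrite addrC natr1 pnatr_eq0.
    rewrite /q; ring.
  apply: has_meanD; last exact: has_mean_Vstatistic.
  apply: has_meanD; first exact: has_mean_cst.
  apply: has_meanZ; apply: has_mean_sum => i; apply: has_mean_sum => j.
  exact/has_meanZ/has_mean_section_sample.
have qc : q + (K - B) / n.+1%:R @[n --> \oo] --> q + (K - B) * 0.
  apply: cvgD; first exact: cvg_cst.
  by apply: cvgMl_tmp; exact: cvg_harmonic.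
rewrite mulr0 addr0 in qc.
by apply: (cvgr_to_ge qc); apply: nearW.
Qed.

(** The expansion of [||mu - mu_n||^2]: [B] is [||mu||^2], the middle sum is the inner product of
    [mu] and [mu_n], the last one is [||mu_n||^2]. *)
Definition embedding_dist2 (n : nat) (w : Omega) : R :=
  B - 2 * \sum_(j < n) n%:R^-1 * mu (X j w)
  + \sum_(i < n) \sum_(j < n) n%:R^-1 * n%:R^-1 * h (X i w) (X j w).

Lemma has_mean_embedding_dist2 n : (0 < n)%N ->
  has_mean P (embedding_dist2 n) ((K - B) / n%:R).
Proof.
move=> n0; rewrite /embedding_dist2.
have -> : (K - B) / n%:R =
    B + (- 2) * \sum_(j < n) n%:R^-1 * B + (B + (K - B) / n%:R).
  rewrite sumr_const card_ord -[_ * B *+ n]mulr_natl mulrA mulfV ?mul1r; first ring.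
  by rewrite pnatr_eq0 -lt0n.
under eq_fun do rewrite -mulNr.
apply: has_meanD; last exact: has_mean_Vstatistic.
apply: has_meanD; first exact: has_mean_cst.
apply: has_meanZ; apply: has_mean_sum => j.
exact/has_meanZ/has_mean_embedding_sample.
Qed.

(** With [L] the sum being squared and [f] the combination with weights [a], positivity for
    [mu - mu_n - L f] reads [0 <= D - 2 L^2 + L^2 Qa], where [D] is [embedding_dist2 n w]. *)
Lemma embedding_CauchySchwarz n w m (xs : 'I_m -> Rd) (a : 'I_m -> R) :
  \sum_(i < m) \sum_(j < m) a i * a j * h (xs i) (xs j) <= 1 ->
  (\sum_(i < m) a i * (mu (xs i) - \sum_(j < n) n%:R^-1 * h (xs i) (X j w))) ^+ 2
    <= embedding_dist2 n w.
Proof.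
set Qa := (X in X <= 1); set L := (X in X ^+ 2) => Qa1.
pose ys (j : 'I_n) : Rd := X j w.
(* The sample enters as ordinary points, at the fixed outcome [w]; the sample averaged in
   [embedding_quadratic_ge0] has been integrated out. *)
have [zs [c cE]] := concat_weights _ _ xs ys (fun i => - L * a i) (fun=> - n%:R^-1).
have := embedding_quadratic_ge0 _ zs c.
have [hsym _] := hpsd.
rewrite (concat_weights_quadratic _ _ _ _ _ _ _ _ _ _ hsym cE) cE.
set Sx := \sum_i a i * mu (xs i).
set Qab := \sum_i \sum_j a i * n%:R^-1 * h (xs i) (ys j).
have LE : L = Sx - Qab.
  rewrite /L /Sx /Qab -sumrB; apply: eq_bigr => i _.
  rewrite mulrBr; congr (_ - _); rewrite mulr_sumr.
  by apply: eq_bigr => j _; rewrite mulrA.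
have -> : \sum_i - L * a i * mu (xs i) = - L * Sx.
  by rewrite mulr_sumr; apply: eq_bigr => i _; rewrite mulrA.
have -> : \sum_(j < n) - n%:R^-1 * mu (ys j) = - \sum_(j < n) n%:R^-1 * mu (X j w).
  by rewrite -sumrN; apply: eq_bigr => i _; rewrite mulNr.
have -> : \sum_i \sum_j - L * a i * (- L * a j) * h (xs i) (xs j) = L ^+ 2 * Qa.
  rewrite mulr_sumr; apply: eq_bigr => i _; rewrite mulr_sumr.
  by apply: eq_bigr => j _; ring.
have -> : \sum_i \sum_j - L * a i * (- n%:R^-1) * h (xs i) (ys j) = L * Qab.
  rewrite mulr_sumr; apply: eq_bigr => i _; rewrite mulr_sumr.
  by apply: eq_bigr => j _; ring.
have -> : \sum_(i < n) \sum_(j < n) - n%:R^-1 * (- n%:R^-1) * h (ys i) (ys j) =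
    \sum_(i < n) \sum_(j < n) n%:R^-1 * n%:R^-1 * h (X i w) (X j w).
  by apply: eq_bigr => i _; apply: eq_bigr => j _; rewrite mulrNN.
have : L ^+ 2 * Qa <= L ^+ 2 * 1 by apply: ler_wpM2l => //; exact: sqr_ge0.
rewrite /embedding_dist2.
set V := \sum_(i < n) \sum_(j < n) n%:R^-1 * n%:R^-1 * h (X i w) (X j w).
set S := \sum_(j < n) n%:R^-1 * mu (X j w).
move=> LQ q0.
have : L * L = L * (Sx - Qab) by rewrite {2}LE.
move: q0 LQ; rewrite expr2; lra.
Qed.

Lemma embedding_dist2_ge0 n w : 0 <= embedding_dist2 n w.
Proof.
have := @embedding_CauchySchwarz n w 0 (fun=> 0) (fun=> 0).
by rewrite !big_ord0 expr0n /=; apply.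
Qed.

Lemma rkhs_norm_embedding_dist n w :
  (`|rkhs_norm h mu - (Num.sqrt ((n%:R ^+ 2)^-1 *
      \sum_(i < n) \sum_(j < n) h (X i w) (X j w)))%:E| <=
   (Num.sqrt (embedding_dist2 n w))%:E)%E.
Proof.
have -> : (n%:R ^+ 2)^-1 * \sum_(i < n) \sum_(j < n) h (X i w) (X j w) =
    \sum_(i < n) \sum_(j < n) n%:R^-1 * n%:R^-1 * h (X i w) (X j w).
  rewrite mulr_sumr; apply: eq_bigr => i _; rewrite mulr_sumr.
  by apply: eq_bigr => j _; rewrite expr2 invfM.
apply: (rkhs_norm_dist_le _ hpsd mu n (fun j => X j w) (fun=> n%:R^-1)).
move=> m xs a a1; rewrite -sqrtr_sqr ler_wsqrtr//.
exact: embedding_CauchySchwarz.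
Qed.

Lemma measurable_Vstatistic_sqrt n : measurable_fun setT (fun w =>
  Num.sqrt ((n%:R ^+ 2)^-1 * \sum_(i < n) \sum_(j < n) h (X i w) (X j w))).
Proof.
apply: (@measurableT_comp _ _ _ _ _ _ (@Num.sqrt R)).
  by apply: continuous_measurable_fun; exact: sqrt_continuous.
apply: measurable_funM => //.
apply: measurable_sum => i; apply: measurable_sum => j.
exact: (measurableT_comp mh (measurable_pair_RV P X i j)).
Qed.

Lemma Vstatistic_bigO : bigO_in_prob P
  (fun n w => `|rkhs_norm h mu - (Num.sqrt ((n%:R ^+ 2)^-1 *
      \sum_(i < n) \sum_(j < n) h (X i w) (X j w)))%:E|%E)
  (fun n => (Num.sqrt n%:R)^-1).
Proof.
move=> eps eps0.
(* Chosen so that Markov's bound [(K - B) / M^2] falls below [eps]; the [+ 1] makes [M] positive and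
   the inequality strict. *)
pose M := Num.sqrt ((`|K - B| + 1) / eps).
have M2 : M ^+ 2 = (`|K - B| + 1) / eps.
  by rewrite sqr_sqrtr// divr_ge0// ?ltW// addr_ge0.
have M0 : 0 < M by rewrite sqrtr_gt0 divr_gt0// ltr_wpDl.
exists M, 1%N => n n0.
have nR : 0 < n%:R :> R by rewrite ltr0n.
have sn0 : 0 < Num.sqrt n%:R :> R by rewrite sqrtr_gt0.
set E := (X in P X).
have mE : measurable E.
  rewrite -[E]setTI; apply: emeasurable_fun_o_infty => //.
  apply: emeasurable_funM => //.
  apply: measurableT_comp => //.
  apply: emeasurable_funB => //; apply/measurable_EFinP.
  exact: measurable_Vstatistic_sqrt.
have [imD _] := has_mean_embedding_dist2 _ n0.
have mD : measurable_fun setT (embedding_dist2 n).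
  exact/measurable_EFinP/(measurable_int _ imD).
(* Squaring turns the deviation event into one about [embedding_dist2], whose mean is
   [(K - B) / n]. *)
apply: (@le_lt_trans _ _ (P [set w | (M ^+ 2 / n%:R <= embedding_dist2 n w)%R])).
  apply: le_measure; rewrite ?inE//.
    rewrite (_ : [set _ | _] =
      setT `&` embedding_dist2 n @^-1` `[M ^+ 2 / n%:R, +oo[); first exact: mD.
    by rewrite setTI; apply/seteqP; split=> w /=; rewrite in_itv/= andbT.
  move=> w; rewrite /E /= invrK => H.
  have := lt_le_trans H (lee_pmul _ _ (rkhs_norm_embedding_dist n w) (lexx _)).
  rewrite lee_fin => /(_ (abse_ge0 _) (ltW sn0)); rewrite -EFinM lte_fin => Mlt.
  rewrite ler_pdivrMr// -(sqr_sqrtr (embedding_dist2_ge0 n w)).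
  rewrite -[n%:R]sqr_sqrtr ?ler0n// -exprMn ler_sqr ?nnegrE; first exact: ltW.
    exact: ltW.
  by rewrite mulr_ge0 ?sqrtr_ge0.
have e0 : 0 < M ^+ 2 / n%:R by rewrite divr_gt0// exprn_gt0.
apply: (le_lt_trans (has_mean_markov _ _ _ _ (embedding_dist2_ge0 n)
  (has_mean_embedding_dist2 _ n0) e0)).
rewrite lte_fin (_ : _ / _ = (K - B) / M ^+ 2); last first.
  by field; rewrite !gt_eqF.
rewrite M2 ltr_pdivrMr; last by rewrite divr_gt0// ltr_wpDl.
rewrite mulrCA mulfV ?gt_eqF// mulr1 (le_lt_trans (ler_norm _))//.
by rewrite ltrDl.
Qed.

End iid_kernel.

(** * Square integrability from the sub-Gaussian norm, and conclusion *)

Lemma psi2_norm_lty_integrable_sqr {R : realType} {dT : measure_display}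
    {T : measurableType dT} (Q : probability T R) (Y : T -> R) :
  measurable_fun setT Y -> (psi2_norm Q Y < +oo)%E ->
  Q.-integrable setT (fun x => (Y x ^+ 2)%:E).
Proof.
move=> mY /ereal_inf_lt[_ [C [C0 intC] <-] _].
have C20 : 0 < C ^+ 2 by rewrite exprn_gt0.
pose g x := C ^+ 2 * (expR (Y x ^+ 2 / C ^+ 2) - 1).
have mexp : measurable_fun setT (fun x => expR (Y x ^+ 2 / C ^+ 2) - 1).
  apply: measurable_funB => //; apply: measurableT_comp => //.
  by apply: measurable_funM => //; exact: measurable_funX.
have exp_ge0 x : 0 <= expR (Y x ^+ 2 / C ^+ 2) - 1.
  by rewrite subr_ge0 -expR0 ler_expR divr_ge0// ?sqr_ge0.
have gi : Q.-integrable setT (EFin \o g).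
  apply: (integrableZl measurableT (C ^+ 2)
    (f := fun x => (expR (Y x ^+ 2 / C ^+ 2) - 1)%:E)).
  apply/integrableP; split; first exact/measurable_EFinP.
  under eq_integral do rewrite gee0_abs ?lee_fin//.
  by rewrite (le_lt_trans intC)// ltry.
apply: (le_integrable measurableT _ _ gi).
  by apply/measurable_EFinP; exact: measurable_funX.
move=> x _ /=; rewrite lee_fin ger0_norm ?sqr_ge0// ger0_norm; last first.
  by rewrite mulr_ge0// ltW.
(* With [y = Y^2 / C^2] the domination is [y <= exp y - 1]. *)
rewrite /g mulrC -ler_pdivrMr//.
by rewrite lerBrDl expR_ge1Dx.
Qed.

Theorem theorem3 (R : realType) (d : nat)
  (k : 'rV[R]_d -> 'rV[R]_d -> R) (p : 'rV[R]_d -> R)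
  (dO : measure_display) (Omega : measurableType dO) (P : probability Omega R)
  (Q : probability 'rV[R]_d R) (X : nat -> {RV P >-> 'rV[R]_d}) :
  (* k : measurable, symmetric positive semidefinite reproducing kernel *)
  measurable_fun setT (fun xy : 'rV[R]_d * 'rV[R]_d => k xy.1 xy.2) ->
  psd_kernel k ->
  (* k continuously differentiable in both arguments (C^{(1,1)}) *)
  continuous (fun xy : 'rV[R]_d * 'rV[R]_d => k xy.1 xy.2) ->
  (forall (i : 'I_d) (x y : 'rV[R]_d),
     [/\ derivable (fun z => k z y) x (e_ i),
         derivable (fun w => k x w) y (e_ i) &
         derivable (fun z => dy k i z y) x (e_ i)]) ->
  (forall i : 'I_d,
     [/\ continuous (fun xy : 'rV[R]_d * 'rV[R]_d => dx k i xy.1 xy.2),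
         continuous (fun xy : 'rV[R]_d * 'rV[R]_d => dy k i xy.1 xy.2) &
         continuous (fun xy : 'rV[R]_d * 'rV[R]_d => dxdy k i xy.1 xy.2)]) ->
  (* p : positive, continuously differentiable density *)
  (forall x, 0 < p x) ->
  continuous p ->
  (forall (i : 'I_d) (x : 'rV[R]_d), derivable p x (e_ i)) ->
  (forall i : 'I_d, continuous (fun x => pderiv p x i)) ->
  (* lim_{||x|| -> oo} f(x) p(x) = 0 for all f in H_k *)
  (forall f : 'rV[R]_d -> R, in_rkhs k f ->
     forall eps : R, 0 < eps -> exists M : R, forall x : 'rV[R]_d,
       M < `|x| -> `|f x * p x| < eps) ->
  (* || ||h_p(.,X)||_{H_{h_p}} ||_{psi_2} < oo  for X ~ Q *)
  (psi2_norm Q (fun x => fine (rkhs_norm (stein_kernel p k)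
                                  (fun z => stein_kernel p k z x))) < +oo)%E ->
  (* X_1, X_2, ... i.i.d. ~ Q *)
  mutually_independent P X ->
  (forall (i : nat) (A : set 'rV[R]_d), measurable A ->
     distribution P (X i) A = Q A) ->
  (* | S_p(Q) - S_p(hat Q_n) | = O_{Q^n}(1 / sqrt n) *)
  bigO_in_prob P
    (fun (n : nat) (w : Omega) =>
       `| KSD p k Q - (KSD_V p k (fun i : 'I_n => X i w))%:E |%E)
    (fun n : nat => (Num.sqrt n%:R)^-1).
Proof.
move=> _ kpsd ck dk cdk p0 cp dp cdp _ psi2 Xindep XQ.
have hpsd : psd_kernel (stein_kernel p k).
  by apply: stein_kernel_psd => // i; case: (cdk i).
have mh : measurable_fun setT
    (fun xy : 'rV[R]_d * 'rV[R]_d => stein_kernel p k xy.1 xy.2).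
  apply: continuous_rV2_measurable; apply: stein_kernel_continuous => // i.
  exact: grad_log_continuous.
have hxx x : 0 <= stein_kernel p k x x.
  by have [_ /(_ 1%N (fun=> x) (fun=> 1))] := hpsd; rewrite !big_ord1 !mul1r.
(* The feature map has the finite norm [sqrt (h x x)], so [fine] keeps its value and the
   sub-Gaussian assumption bears on the diagonal of the kernel. *)
have feature_norm : (fun x => fine (rkhs_norm (stein_kernel p k)
      (fun z => stein_kernel p k z x))) =
    fun x => Num.sqrt (stein_kernel p k x x).
  by apply/funext => x; rewrite rkhs_norm_section.
have hdiag : Q.-integrable setT (fun x => (stein_kernel p k x x)%:E).
  rewrite (_ : (fun x => _) =
      fun x => (Num.sqrt (stein_kernel p k x x) ^+ 2)%:E); last first.
    by apply/funext => x; rewrite sqr_sqrtr.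
  apply: psi2_norm_lty_integrable_sqr; last by rewrite -feature_norm.
  apply: (@measurableT_comp _ _ _ _ _ _ (@Num.sqrt R)).
    by apply: continuous_measurable_fun; exact: sqrt_continuous.
  exact: (measurable_kernel_diag _ mh).
(* [KSD] and [KSD_V] unfold to the norm of the mean embedding and the root of the V-statistic. *)
exact: (Vstatistic_bigO P Q (stein_kernel p k) X hpsd mh hdiag Xindep XQ).
Qed.
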